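(* Let $G$ be a graph on $n$ vertices, let $\lambda$ be a partition of $n$, and let $0\le r\le n$. Then $$c_{\lambda,r}(L(S_{n}))\leq c_{\lambda,r}(L(G))\leq c_{\lambda,r}(L(K_{n})).$$
   Context: Graphs are finite and simple. $L(G)=D(G)-A(G)$ is the Laplacian matrix of $G$ ($D(G)$ the diagonal degree matrix, $A(G)$ the adjacency matrix). $S_n$ and $K_n$ denote the star and the complete graph on $n$ vertices. For a partition $\lambda$ of $n$, $\chi_\lambda$ is the irreducible character of the symmetric group $\mathcal{S}_n$ indexed by $\lambda$. For an $n\times n$ matrix $M=[m_{ij}]$, $\operatorname{Imm}_\lambda(M)=\sum_{\sigma\in\mathcal{S}_n}\chi_\lambda(\sigma)\prod_{i=1}^n m_{i\sigma(i)}$, and the coefficients $c_{\lambda,r}(M)$ are defined by $\operatorname{Imm}_\lambda(xI_n-M)=\sum_{r=0}^n(-1)^r c_{\lambda,r}(M)x^{n-r}$.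
   Formalization: The lower bound by the star is stated only for connected G, since it fails for disconnected graphs (e.g. n = 2, G edgeless, λ = (2), r = 1 would give 2 ≤ 0); the upper bound by the complete graph is stated for every graph G. *)

(* Defs.v *)
From HB Require Import structures.
From mathcomp Require Import all_boot all_order all_algebra.
From mathcomp Require Import all_fingroup all_solvable all_field all_character.

Set Implicit Arguments.
Unset Strict Implicit.
Unset Printing Implicit Defensive.

Import Order.TTheory GRing.Theory Num.Theory.
Local Open Scope ring_scope.

Definition adjacency_mx n (e : rel 'I_n) : 'M[algC]_n :=
  \matrix_(i, j) (e i j)%:R.

Definition degree_mx n (e : rel 'I_n) : 'M[algC]_n :=
  diag_mx (\row_i #|[pred j | e i j]|%:R).

Definition laplacian n (e : rel 'I_n) : 'M[algC]_n :=
  degree_mx e - adjacency_mx e.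

(* The centre is the vertex of value 0. *)
Definition star n : rel 'I_n :=
  [rel i j : 'I_n | (i != j) && ((i == 0%N :> nat) || (j == 0%N :> nat))].

Definition complete n : rel 'I_n := [rel i j : 'I_n | i != j].

Definition connected n (e : rel 'I_n) : Prop := forall i j, connect e i j.

Definition is_partition n (lam : seq nat) : bool :=
  [&& sorted geq lam, 0%N \notin lam & sumn lam == n].

(* The canonical tableau of shape lam is filled with 0, 1, ..., n - 1 row by
   row, so that the entry i lies in row (reshape_index lam i) and in column
   (reshape_offset lam i). *)
Definition row_stabilizer n (lam : seq nat) : {set 'S_n} :=
  [set p : 'S_n | [forall i, reshape_index lam (p i) == reshape_index lam i]].

Definition column_stabilizer n (lam : seq nat) : {set 'S_n} :=
  [set q : 'S_n | [forall i, reshape_offset lam (q i) == reshape_offset lam i]].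

(* The Young symmetrizer, as a row vector of the regular representation.
   MathComp composes permutations from left to right, so (q * p)%g is p after q
   and this is the usual a_lam b_lam. *)
Definition young_symmetrizer n (lam : seq nat) : 'rV[algC]_#|[set: 'S_n]| :=
  \sum_(p in row_stabilizer n lam) \sum_(q in column_stabilizer n lam)
     (-1) ^+ q *: delta_mx 0 (gring_index [set: 'S_n]%G (q * p)%g).

(* MathComp's regular representation acts by right multiplication, that is, by
   left multiplication for the usual composition of permutations: the submodule
   generated by the Young symmetrizer is the left ideal C[S_n] a_lam b_lam. *)
Definition specht_repr n (lam : seq nat) :=
  submod_repr (cyclic_mx_module (regular_repr algC [set: 'S_n]%G)
                                (young_symmetrizer n lam)).

Definition sym_char n (lam : seq nat) : 'CF([set: 'S_n]) :=
  cfRepr (specht_repr n lam).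

(* Entries in an arbitrary commutative algebra over algC, so that the immanant
   applies to the polynomial matrix x I_n - M. *)
Definition immanant (A : comAlgType algC) n (lam : seq nat) (M : 'M[A]_n)
  : A := \sum_(s : 'S_n) sym_char n lam s *: \prod_(i < n) M i (s i).

(* [char_poly_mx M] is the matrix x I_n - M. *)
Definition immanantal_poly n (lam : seq nat) (M : 'M[algC]_n) : {poly algC} :=
  immanant lam (char_poly_mx M).

Definition imm_coef n (lam : seq nat) (r : nat) (M : 'M[algC]_n) : algC :=
  (-1) ^+ r * (immanantal_poly lam M)`_(n - r).

Lemma immanantal_polyE n (lam : seq nat) (M : 'M[algC]_n) :
  immanantal_poly lam M =
  \sum_(r < n.+1) ((-1) ^+ r * imm_coef lam r M) *: 'X^(n - r).
Proof.
have sz : (size (immanantal_poly lam M) <= n.+1)%N.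
  apply: (leq_trans (size_sum _ _ _)); apply/bigmax_leqP => s _.
  apply: (leq_trans (size_scale_leq _ _)).
  apply: (leq_trans (size_prod_leq _ _)).
  rewrite cardT size_enum_ord leq_subLR addnS ltnS addnn -muln2.
  rewrite -[in leqRHS](card_ord n) -sum_nat_const.
  apply: leq_sum => i _; rewrite !mxE.
  apply: (leq_trans (size_polyD _ _)); rewrite geq_max size_polyN.
  rewrite (leq_trans (size_polyC_leq1 _)) // andbT.
  by case: eqP => _; rewrite ?mulr1n ?mulr0n ?size_polyX ?size_poly0.
rewrite -[LHS](coefK) (poly_def (size _)).
rewrite (big_ord_widen _ (fun i => (immanantal_poly lam M)`_i *: 'X^i) sz).
rewrite big_mkcond (reindex_inj rev_ord_inj) /=.
apply: eq_bigr => r _; rewrite subSS /imm_coef mulrA -expr2 sqrr_sign mul1r.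
by case: ltnP => // h; rewrite nth_default // scale0r.
Qed.

(* Main.v *)
Require Import Defs.
From mathcomp Require Import all_boot all_order all_algebra all_field.
From mathcomp Require Import all_fingroup all_character zify ring.

Set Implicit Arguments.
Unset Strict Implicit.
Unset Printing Implicit Defensive.

Import Order.TTheory GRing.Theory Num.Theory.
Local Open Scope ring_scope.

(** Why the inequalities hold.  For r <= n, the coefficient of x^(n-r) is, up to
    the sign that c_r removes, a sum over maps f that choose, in every row i of
    xI - M, one summand of that row; the value of f is a sum of character values
    over permutations (imm_coef_expand).  Two ways of writing L as a sum give the two bounds.

    Upper bound, and reduction to trees.  L is a sum of Gram matrices v v^T, one
    for each edge.  Summed over a set of choices closed under permuting the
    rows, the contributions become values of the Hermitian form
    chi(a^-1 b) w(a) w(b)^*, which is positive semidefinite for every character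
    chi (char_pos_semidef).  Adding an edge only adds choices, so c_r grows with
    the edge set (imm_coef_laplacian_mono).  This gives the bound by the
    complete graph, and the bound from below by any spanning tree.

    Trees.  Row i of L is the sum, over the neighbours u of i, of
    delta_i - delta_u.  So c_r is a sum over the choices of r vertices and of an
    arrow along an edge at each of them, and such a choice h contributes the
    alternating sum of chi over the permutations that move points only along
    arrows (the followers of h).  In a tree such permutations are involutions
    (along_tree_involution): they form the group generated by the disjoint
    transpositions along the edges whose two ends choose each other, and the
    signs are all 1 by 2-colouring.  The contribution is therefore |H| times the
    multiplicity of the trivial character in the restriction of chi to a
    subgroup H, hence nonnegative, and it depends only on the number of edges
    chosen from both ends.

    The star.  At most one edge of a star is chosen from both ends.  So it
    suffices to inject the choices of the star into those of the tree while
    preserving r and that number (imm_coef_star_le_tree).  Take the centre as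
    the root of the tree, and match the edge of the star at v with the edge of
    the tree from v to its parent.  If the centre chooses nothing, the arrow
    from v to the centre becomes the arrow from v to its parent.  If the centre
    chooses u, the same is done, and then the arrows on the path that climbs
    from u through the used edges are reversed, so that this component of the
    used forest is directed towards u (reroute).  The reversed path ends at u,
    so u can be read off from the image. *)

(** * Positive semidefiniteness of characters *)

(** An irreducible character is, up to a positive factor, its own convolution
    square (generalized orthogonality), which turns the form into a sum of
    squared absolute values. *)
Lemma irr_pos_semidef (gT : finGroupType) (G : {group gT}) (k : Iirr G)
    (w : gT -> algC) :
  0 <= \sum_(a in G) \sum_(b in G) 'chi_k (a^-1 * b)%g * w a * (w b)^*.
Proof.
have cG0 : #|G|%:R != 0 :> algC by rewrite pnatr_eq0 -lt0n cardG_gt0.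
suff -> : \sum_(a in G) \sum_(b in G) 'chi_k (a^-1 * b)%g * w a * (w b)^* =
    ('chi_k 1%g / #|G|%:R) *
    \sum_(g in G) `|\sum_(a in G) 'chi_k (g * a)%g * (w a)^*| ^+ 2.
  apply: mulr_ge0; first by rewrite divr_ge0 ?ler0n // ltW // irr1_gt0.
  by apply: sumr_ge0 => g _; rewrite exprn_ge0.
have conv a b : a \in G -> 'chi_k (a^-1 * b)%g = ('chi_k 1%g / #|G|%:R) *
    \sum_(g in G) 'chi_k (g * b)%g * ('chi_k (g * a)%g)^*.
  move=> Ga; have := generalized_orthogonality_relation (a^-1 * b)%g k k.
  rewrite eqxx mul1r => /(canLR (divfK (irr1_neq0 k))) <-.
  rewrite mulrC mulrA; congr (_ * _).
  rewrite (reindex_inj (mulIg a)) /=.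
  apply: eq_big => [g | g _]; first by rewrite groupMr.
  by rewrite mulgA mulgK irr_inv.
have sq g : `|\sum_(a in G) 'chi_k (g * a)%g * (w a)^*| ^+ 2 =
    \sum_(a in G) \sum_(b in G)
      'chi_k (g * b)%g * ('chi_k (g * a)%g)^* * w a * (w b)^*.
  rewrite normCK rmorph_sum mulr_sumr; apply: eq_bigr => a _.
  rewrite mulr_suml; apply: eq_bigr => b _; rewrite rmorphM /= conjCK.
  by rewrite -!mulrA; congr (_ * _); rewrite [LHS]mulrC mulrA.
rewrite (eq_bigr _ (fun g _ => sq g)) [in RHS]exchange_big mulr_sumr.
apply: eq_bigr => a Ga; rewrite [in RHS]exchange_big mulr_sumr; apply: eq_bigr => b _.
rewrite conv // -!mulrA !mulr_suml; congr (_ * (_ * _)).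
by apply: eq_bigr => g _; rewrite !mulrA.
Qed.

Lemma char_pos_semidef (gT : finGroupType) (G : {group gT}) (chi : 'CF(G))
    (w : gT -> algC) : chi \is a character ->
  0 <= \sum_(a in G) \sum_(b in G) chi (a^-1 * b)%g * w a * (w b)^*.
Proof.
case/char_sum_irr=> s ->.
under eq_bigr => a _ do under eq_bigr => b _ do rewrite sum_cfunE !mulr_suml.
under eq_bigr => a _ do rewrite exchange_big.
rewrite exchange_big; apply: sumr_ge0 => k _; exact: irr_pos_semidef.
Qed.

(** * Expanding immanantal coefficients *)

Lemma sym_char_char n lam : @sym_char n lam \is a character.
Proof. exact: cfRepr_char. Qed.

(** Multilinearity in the rows.  Each row i of xI - M is written as a sum of
    rows c i u indexed by u; the summands selected by X make up xI, the others
    make up M, with signs that cancel the (-1)^r in the coefficient. *)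
Lemma imm_coef_expand (n : nat) (U : finType) (lam : seq nat) (r : nat)
    (M : 'M[algC]_n) (P X : 'I_n -> pred U) (c : 'I_n -> U -> 'I_n -> algC) :
    (r <= n)%N ->
    (forall i j, \sum_(u | P i u && X i u) c i u j = (i == j)%:R) ->
    (forall i j, \sum_(u | P i u && ~~ X i u) c i u j = M i j) ->
  imm_coef lam r M =
  \sum_(f : {ffun 'I_n -> U} | (f \in family P) &&
                               (#|[pred i | ~~ X i (f i)]| == r))
     \sum_(s : 'S_n) sym_char n lam s * \prod_i c i (f i) (s i).
Proof.
move=> le_rn cX cM; rewrite /imm_coef /immanantal_poly /immanant.
pose y i u : {poly algC} := if X i u then 'X else -1.
have entry i j : char_poly_mx M i j =
    \sum_(u | P i u) y i u * (c i u j)%:P.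
  rewrite (bigID (X i)) /= !mxE -cM -mulr_natl.
  rewrite -[X in X * 'X](rmorph_nat polyC) -cX !rmorph_sum mulr_suml.
  rewrite -sumrN; congr (_ + _); apply: eq_bigr => u /andP[_ Xu]; rewrite /y.
    by rewrite Xu mulrC.
  by rewrite (negPf Xu) mulN1r.
have prodE s : \prod_i char_poly_mx M i (s i) =
    \sum_(f in family P) (-1) ^+ #|[pred i | ~~ X i (f i)]| *:
       ((\prod_i c i (f i) (s i)) *: 'X^(#|[pred i | X i (f i)]|)).
  rewrite (eq_bigr _ (fun i _ => entry i (s i))) bigA_distr_big_dep.
  apply: eq_bigr => f _; rewrite big_split /= -rmorph_prod /= mulrC.
  rewrite mul_polyC scalerA mulrC -scalerA; congr (_ *: _).
  rewrite (bigID (fun i => X i (f i))) /=.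
  rewrite (eq_bigr (fun=> 'X)) => [|i Xi]; last by rewrite /y Xi.
  rewrite [X in _ * X](eq_bigr (fun=> -1)) => [|i /negPf Xi].
    rewrite !prodr_const mulrC -[-1]/(- 1%:P) -polyCN -rmorphXn /= mul_polyC.
    by [].
  by rewrite /y Xi.
under eq_bigr => s _ do rewrite prodE scaler_sumr.
rewrite exchange_big coef_sum mulr_sumr [RHS]big_mkcondr /=.
apply: eq_bigr => f _; rewrite coef_sum.
have cardX : (#|[pred i | X i (f i)]| + #|[pred i | ~~ X i (f i)]|)%N = n.
  by rewrite (cardC [pred i | X i (f i)]) card_ord.
have -> : (#|[pred i | ~~ X i (f i)]| == r) =
          (#|[pred i | X i (f i)]| == n - r)%N.
  by move: cardX le_rn; lia.
rewrite eq_sym; case: ifP => [/eqP h | h]; last first.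
  by rewrite big1 ?mulr0 // => s _; rewrite !coefZ coefXn h !mulr0.
rewrite mulr_sumr; apply: eq_bigr => s _.
rewrite !coefZ coefXn h eqxx mulr1.
have -> : r = #|[pred i | ~~ X i (f i)]|.
  by move: cardX le_rn h; lia.
by rewrite [LHS]mulrCA; congr (_ * _); rewrite mulrA -expr2 sqrr_sign mul1r.
Qed.

(** * Monotonicity in the edge set *)

(** Averaging over all permutations of the positions turns the sum over s of
    chi s into the form chi(a^-1 b) w(a) w(b)^* with
    w(a) = \prod_i v (f i) (a i); a single f may contribute a negative number,
    which is why S has to be invariant. *)
Lemma gram_orbit_sum_ge0 (n : nat) (U : finType) (v : U -> 'I_n -> algC)
    (chi : 'CF([set: 'S_n])) (S : pred {ffun 'I_n -> U}) :
    chi \is a character ->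
    (forall (f : {ffun 'I_n -> U}) (t : 'S_n), S [ffun i => f (t i)] = S f) ->
  0 <= \sum_(f : {ffun 'I_n -> U} | S f)
         \sum_(s : 'S_n) chi s * \prod_i (v (f i) i * (v (f i) (s i))^*).
Proof.
move=> chiC Sinv; set X := (X in 0 <= X).
pose w (f : {ffun 'I_n -> U}) (a : 'S_n) := \prod_i v (f i) (a i).
have Xa (a : 'S_n) : X = \sum_(f | S f)
    \sum_(b in [set: 'S_n]) chi (a^-1 * b)%g * w f a * (w f b)^*.
  pose shift (t : 'S_n) (f : {ffun 'I_n -> U}) := [ffun i => f (t i)].
  rewrite /X (reindex (shift a^-1%g)) /=; last first.
    exists (shift a) => f _; apply/ffunP=> i; rewrite !ffunE.
      by rewrite permK.
    by rewrite permKV.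
  apply: eq_big => [f | f _]; first by rewrite Sinv.
  rewrite (reindex_inj (mulgI a^-1%g)) /=.
  apply: eq_big => [b | b _]; first by rewrite inE.
  rewrite -mulrA; congr (_ * _); rewrite (reindex_inj (@perm_inj _ a)) /=.
  rewrite /w rmorph_prod -big_split /=; apply: eq_bigr => i _.
  by rewrite !ffunE permK permM permK.
suff : 0 <= X *+ #|[set: 'S_n]|.
  by rewrite pmulrn_lge0 // cardG_gt0.
rewrite -sumr_const (eq_bigr _ (fun a _ => Xa a)) exchange_big.
by apply: sumr_ge0 => f _; apply: char_pos_semidef.
Qed.

Lemma laplacian_row (n : nat) (e : rel 'I_n) (i j : 'I_n) : irreflexive e ->
  \sum_(u | e i u) ((j == i)%:R - (j == u)%:R) = laplacian e i j.
Proof.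
move=> e_irr; rewrite sumrB !mxE sumr_const eq_sym; congr (_ - _).
  by case: (_ == _); rewrite ?mulr1n ?mulr0n ?mul0rn.
rewrite big_mkcond (bigD1 j) //= eqxx big1 ?addr0; first by case: (e i j).
by move=> u /negPf; rewrite eq_sym => ->; rewrite if_same.
Qed.

(** A pair (a, a) stands for the unit vector of a, so that these pairs produce
    the identity matrix; a pair of distinct vertices stands for an oriented
    edge, and the factor sqrt(1/2) makes up for the two orientations. *)
Definition edge_vector (n : nat) (u : 'I_n * 'I_n) (k : 'I_n) : algC :=
  if u.1 == u.2 then (k == u.1)%:R
  else sqrtC 2^-1 * ((k == u.1)%:R - (k == u.2)%:R).

Lemma edge_vector_conj (n : nat) (u : 'I_n * 'I_n) (k : 'I_n) :
  (edge_vector u k)^* = edge_vector u k.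
Proof.
rewrite /edge_vector; case: ifP => _; first exact: conjC_nat.
rewrite rmorphM rmorphB /= !conjC_nat; congr (_ * _).
by apply: geC0_conj; rewrite sqrtC_ge0 invr_ge0 ler0n.
Qed.

Lemma laplacian_gram (n : nat) (e : rel 'I_n) (i j : 'I_n) :
    symmetric e -> irreflexive e ->
  \sum_(u : 'I_n * 'I_n | ((u.1 == u.2) || e u.1 u.2) && (u.1 != u.2))
    edge_vector u i * (edge_vector u j)^* = laplacian e i j.
Proof.
move=> e_sym e_irr.
pose d (a b : 'I_n) : algC := (a == b)%:R.
have -> : \sum_(u : 'I_n * 'I_n | ((u.1 == u.2) || e u.1 u.2) && (u.1 != u.2))
    edge_vector u i * (edge_vector u j)^* =
  2^-1 * \sum_a \sum_(b | e a b) (d i a - d i b) * (d j a - d j b).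
  rewrite pair_big_dep /= mulr_sumr; apply: eq_big => [[a b]|[a b] /=].
    by rewrite /=; case: eqP => [->|_] /=; rewrite ?e_irr ?andbT.
  move=> /andP[_ /negPf ab]; rewrite edge_vector_conj /edge_vector /= ab.
  by rewrite mulrACA -expr2 sqrtCK.
(* Swapping a and b shows that both terms of the factor d i a - d i b
   contribute the same amount. *)
have half : \sum_a \sum_(b | e a b) d i a * (d j a - d j b) = laplacian e i j.
  rewrite (bigD1 i) //= [X in _ + X]big1 ?addr0 => [|a /negPf ai].
    by rewrite -laplacian_row //; apply: eq_bigr => b _; rewrite /d eqxx mul1r.
  by apply: big1 => b _; rewrite /d eq_sym ai mul0r.
have -> : \sum_a \sum_(b | e a b) (d i a - d i b) * (d j a - d j b) =
    laplacian e i j *+ 2.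
  rewrite mulr2n -[in RHS]half.
  have -> : \sum_a \sum_(b | e a b) d i a * (d j a - d j b) +
      \sum_a \sum_(b | e a b) d i a * (d j a - d j b) =
      \sum_a \sum_(b | e a b) d i a * (d j a - d j b) +
      \sum_a \sum_(b | e a b) d i b * (d j b - d j a).
    congr (_ + _); rewrite [RHS](exchange_big_dep xpredT) //=.
    by apply: eq_bigr => a _; apply: eq_bigl => b; rewrite e_sym.
  rewrite -big_split; apply: eq_bigr => a _; rewrite -big_split.
  by apply: eq_bigr => b _ /=; ring.
by rewrite -[laplacian e i j *+ 2]mulr_natl mulKf // pnatr_eq0.
Qed.

Lemma imm_coef_laplacian_mono (n : nat) (e e' : rel 'I_n) lam r :
    symmetric e -> irreflexive e -> symmetric e' -> irreflexive e' ->
    subrel e e' -> (r <= n)%N ->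
  imm_coef lam r (laplacian e) <= imm_coef lam r (laplacian e').
Proof.
move=> e_sym e_irr e_sym' e_irr' sub_ee' le_rn.
pose P (e : rel 'I_n) (i : 'I_n) := [pred u | (u.1 == u.2) || e u.1 u.2].
pose X (i : 'I_n) (u : 'I_n * 'I_n) := u.1 == u.2.
pose c (i : 'I_n) u (j : 'I_n) := edge_vector u i * (edge_vector u j)^*.
have cX e0 i j : \sum_(u | P e0 i u && X i u) c i u j = (i == j)%:R.
  rewrite (eq_bigl (fun u => predT u.1 && (u.1 == u.2))); last first.
    by move=> [a b]; rewrite /P /X /=; case: eqP; rewrite ?andbT ?andbF.
  rewrite -(pair_big_dep predT (fun a b : 'I_n => a == b)
    (fun a b => c i (a, b) j)) /=.
  rewrite (bigD1 i) //= [X in _ + X]big1 ?addr0 => [|a /negPf ai].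
    rewrite (big_pred1 i) => [|b]; last by rewrite eq_sym.
    by rewrite /c edge_vector_conj /edge_vector /= !eqxx mul1r eq_sym.
  rewrite (big_pred1 a) => [|b]; last by rewrite eq_sym.
  by rewrite /c /edge_vector /= eqxx eq_sym ai mul0r.
rewrite (@imm_coef_expand _ _ _ _ _ (P e) X c) //; last first.
  by move=> i j; apply: laplacian_gram.
rewrite (@imm_coef_expand _ _ _ _ _ (P e') X c) //; last first.
  by move=> i j; apply: laplacian_gram.
have famS f : f \in family (P e) -> f \in family (P e').
  move/familyP=> fP; apply/familyP=> i; move: (fP i); rewrite !inE.
  by case/orP=> [->|/sub_ee' ->] //; rewrite orbT.
rewrite [leRHS](bigID (fun f => f \in family (P e))) /= -subr_ge0.
rewrite [X in _ <= X + _ - _](eq_bigl (fun f => (f \in family (P e)) &&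
  (#|[pred i | ~~ X i (f i)]| == r))); last first.
  by move=> f; case: (boolP (f \in family (P e))) => [/famS ->|]; rewrite ?andbF ?andbT.
rewrite addrC addrA addNr add0r.
have famJ e0 (f : {ffun 'I_n -> _}) (t : 'S_n) :
    ([ffun i => f (t i)] \in family (P e0)) = (f \in family (P e0)).
  apply/familyP/familyP=> fP i; last by rewrite ffunE; apply: (fP (t i)).
  by move: (fP (t^-1%g i)); rewrite ffunE permKV.
apply: gram_orbit_sum_ge0 => [|f t]; first exact: sym_char_char.
rewrite !famJ; congr (_ && (_ == _) && _).
rewrite -[LHS](card_image (@perm_inj _ t)); apply: eq_card => i.
rewrite inE; apply/imageP/idP => [[k kP ->]|iP].
  by move: kP; rewrite inE ffunE.
by exists (t^-1%g i); rewrite ?permKV // inE ffunE permKV.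
Qed.

(** * Laplacians of trees *)

(** The edges {v, p v} for v different from the root [ord0].  Together with
    [depth_for], which excludes cycles, this encodes a rooted tree. *)
Definition parent_rel (m : nat) (p : 'I_m.+1 -> 'I_m.+1) : rel 'I_m.+1 :=
  [rel i j | (i != ord0) && (p i == j) || (j != ord0) && (p j == i)].

Definition depth_for (m : nat) (p : 'I_m.+1 -> 'I_m.+1) (d : 'I_m.+1 -> nat) :=
  forall v, v != ord0 -> d v = (d (p v)).+1.

Lemma parent_rel_sym m (p : 'I_m.+1 -> 'I_m.+1) : symmetric (parent_rel p).
Proof. by move=> i j; exact: orbC. Qed.

Lemma parent_neq m (p : 'I_m.+1 -> 'I_m.+1) d (v : 'I_m.+1) :
  depth_for p d -> v != ord0 -> p v != v.
Proof. by move=> dP /dP dv; apply/eqP=> pv; rewrite pv in dv; lia. Qed.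

Lemma parent_rel_irr m (p : 'I_m.+1 -> 'I_m.+1) d :
  depth_for p d -> irreflexive (parent_rel p).
Proof.
move=> dP i; rewrite /parent_rel /= orbb.
case: (boolP (i == ord0)) => //= i0; exact: negbTE (parent_neq dP i0).
Qed.

(** A set of r vertices together with a neighbour of each of them, encoded as
    the map that sends these vertices to the chosen neighbours and fixes all
    others.  As e is irreflexive in all uses, no information is lost. *)
Definition arrows (n : nat) (e : rel 'I_n) (r : nat) : pred {ffun 'I_n -> 'I_n} :=
  [pred h : {ffun 'I_n -> 'I_n} | [forall i, (h i == i) || e i (h i)] &&
            (#|[pred i | h i != i]| == r)].

Definition followers (n : nat) (h : 'I_n -> 'I_n) : {set 'S_n} :=
  [set s : 'S_n | [forall i, (s i == i) || (s i == h i)]].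

Lemma followersP n (h : 'I_n -> 'I_n) (s : 'S_n) :
  reflect (forall i, s i = i \/ s i = h i) (s \in followers h).
Proof.
rewrite inE; apply: (iffP forallP) => hs i.
  by case/orP: (hs i) => /eqP; [left | right].
by case: (hs i) => ->; rewrite eqxx ?orbT.
Qed.

(** Row i of the Laplacian is the sum of delta_i - delta_u over the neighbours
    u of i, and the entry of delta_i - delta_u at u is -1; since trees are
    bipartite, the signs can be
    removed by scaling the rows and columns with (-1)^depth. *)
Lemma imm_coef_tree m (p : 'I_m.+1 -> 'I_m.+1) d lam r :
    depth_for p d -> (r <= m.+1)%N ->
  imm_coef lam r (laplacian (parent_rel p)) =
  \sum_(h | arrows (parent_rel p) r h) \sum_(s in followers h)
     sym_char m.+1 lam s.
Proof.
move=> dP le_rn; have e_irr := parent_rel_irr dP.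
set e := parent_rel p in e_irr *.
pose P (i u : 'I_m.+1) := (u == i) || e i u.
pose X (i u : 'I_m.+1) := u == i.
pose c (i u j : 'I_m.+1) : algC :=
  if u == i then (j == i)%:R else (j == i)%:R - (j == u)%:R.
rewrite (@imm_coef_expand _ _ _ _ _ P X c) //; first last.
- move=> i j; rewrite -laplacian_row //; apply: eq_big => [u | u].
    rewrite /P /X; case: eqP => [->|_]; rewrite ?e_irr ?andbT //.
  by rewrite /X /c => /andP[_ /negPf ->].
- move=> i j; rewrite (big_pred1 i) => [|u]; first by rewrite /c eqxx eq_sym.
  by rewrite /P /X /=; case: (u == i); rewrite ?andbF.
have arrE h : (h \in family P) && (#|[pred i | ~~ X i (h i)]| == r) =
    arrows e r h.
  by rewrite /arrows /=; congr (_ && _); apply/familyP/forallP => hP i;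
    move: (hP i); rewrite inE.
apply: eq_big => [h | h]; first exact: arrE.
rewrite arrE => /andP[/forallP hP _]; rewrite [RHS]big_mkcond /=.
apply: eq_bigr => s _; case: (followersP h s) => [sP | /(introN (followersP h s)) sP].
  (* A move along a tree edge changes the depth by one, so the factor of i is
     sg i * sg (s i); the product over all i is a product of squares. *)
  pose sg i : algC := (-1) ^+ d i.
  have cE i : c i (h i) (s i) = sg i * sg (s i).
    rewrite /c; have [->|si] := eqVneq (s i) i.
      rewrite /sg -expr2 sqrr_sign; case: eqP => // /eqP /negPf hi.
      by rewrite eq_sym hi subr0.
    case: (sP i) => sih; first by rewrite sih eqxx in si.
    rewrite -sih (negPf si) eqxx sub0r /sg -exprD.
    have : (d i + d (s i) = (d i).*2.+1 \/ d i + d (s i) = (d (s i)).*2.+1)%N.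
      move: (hP i); rewrite -sih (negPf si) /=.
      case/orP=> /andP[/dP -> /eqP ->]; [right | left]; lia.
    by case=> ->; rewrite exprS -mul2n exprM sqrrN expr1n expr1n mulr1.
  rewrite (eq_bigr _ (fun i _ => cE i)) big_split /=.
  rewrite -(reindex_inj (@perm_inj _ s) (F := sg) (P := predT)) -big_split.
  by rewrite big1 ?mulr1 // => i _; rewrite /= /sg -expr2 sqrr_sign.
move: sP; rewrite inE => /forallPn[i]; rewrite negb_or => /andP[si sh].
rewrite (bigD1 i) //= /c (negPf si) (negPf sh).
by rewrite subr0 if_same mul0r mulr0.
Qed.

(** A deepest point k of a nontrivial cycle of s is entered from, and left to,
    its parent, as it has no other neighbour in the cycle.  So s^2 fixes k, hence
    the whole cycle. *)
Lemma along_tree_involution m (p : 'I_m.+1 -> 'I_m.+1) d (s : 'S_m.+1) :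
    depth_for p d -> (forall i, s i = i \/ parent_rel p i (s i)) ->
  forall i, s (s i) = i.
Proof.
move=> dP sP i.
have [k ik kmax] : {k | k \in porbit s i & forall j, j \in porbit s i -> (d j <= d k)%N}.
  case: (arg_maxnP (P := mem (porbit s i)) d (porbit_id s i)) => k ik kmax.
  by exists k.
have orbS j : porbit s (s j) = porbit s j.
  by have := porbit_perm s 1 j; rewrite expg1.
have dmax j : porbit s j = porbit s k -> (d j <= d k)%N.
  move: ik; rewrite -eq_porbit_mem => /eqP ki jk.
  by apply: kmax; rewrite -ki -jk porbit_id.
have ssk : s (s k) = k.
  have [sk|[k0 sk]] : s k = k \/ (k != ord0 /\ s k = p k).
  - case: (sP k) => [|/orP[]/andP[k0 /eqP pk]]; [by left | by right | ].
    by have := dmax _ (orbS k); rewrite (dP _ k0) pk ltnn.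
  - by rewrite !sk.
  pose j := (s^-1)%g k; have sj : s j = k by rewrite permKV.
  have jk : porbit s j = porbit s k by rewrite -[in RHS]sj orbS.
  move: (sP j); rewrite sj => [][kj|/orP[]/andP[j0 /eqP pj]].
  - by have sk1 : s k = k; [rewrite -[RHS]sj -kj | rewrite !sk1].
  - by have := dmax _ jk; rewrite (dP _ j0) pj ltnn.
  by rewrite sk pj.
case/porbitP: ik => a ka; apply: (@perm_inj _ (s ^+ a)%g).
have cm x : (s ^+ a)%g (s x) = s ((s ^+ a)%g x).
  by rewrite -!permM -expgS expgSr.
by rewrite !cm -ka.
Qed.

(** Up to the factor |H|, the sum is the multiplicity of the trivial character
    of H in the restriction of chi. *)
Lemma char_sum_subgroup_ge0 (gT : finGroupType) (G H : {group gT})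
    (chi : 'CF(G)) :
  chi \is a character -> H \subset G -> 0 <= \sum_(x in H) chi x.
Proof.
move=> chiC sHG.
have := Cnat_cfdot_char (cfRes_char H chiC) (rpred1 _ : (1 : 'CF(H)) \is a character).
move/natr_ge0; rewrite cfdotE pmulr_rge0 ?invr_gt0 ?ltr0n ?cardG_gt0 //.
rewrite (eq_bigr chi) // => x Hx.
by rewrite cfResE // cfun1E Hx conjC1 mulr1.
Qed.

Definition tree_arrow (m : nat) (p h : 'I_m.+1 -> 'I_m.+1) :=
  forall i, h i = i \/ parent_rel p i (h i).

(** The edges chosen from both ends, each represented by its lower end. *)
Definition turns (m : nat) (p h : 'I_m.+1 -> 'I_m.+1) : pred 'I_m.+1 :=
  [pred v | [&& v != ord0, h v == p v & h (p v) == v]].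

Lemma follower_swap m (p : 'I_m.+1 -> 'I_m.+1) d h (s : 'S_m.+1) i :
    depth_for p d -> tree_arrow p h -> s \in followers h -> s i != i ->
  [/\ s i = h i, s (h i) = i & h (h i) = i].
Proof.
move=> dP hP /followersP sP si.
have inv : forall j, s (s j) = j.
  apply: (along_tree_involution dP) => j.
  by case: (sP j) => [|->]; [left | apply: hP].
have sh : s i = h i by case: (sP i) => // sii; rewrite sii eqxx in si.
rewrite -sh inv; split=> //; case: (sP (s i)); rewrite inv => // iE.
by rewrite -iE eqxx in si.
Qed.

Lemma follower_turn m (p : 'I_m.+1 -> 'I_m.+1) d h (s : 'S_m.+1) i :
    depth_for p d -> tree_arrow p h -> s \in followers h -> s i != i ->
  turns p h i \/ turns p h (s i) /\ i = p (s i).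
Proof.
move=> dP hP sF si; have [sh _ hh] := follower_swap dP hP sF si.
rewrite sh in si *; case: (hP i) => [hi|]; first by rewrite hi eqxx in si.
case/orP=> /andP[v0 /eqP pv]; [left | right]; rewrite /turns /= pv v0 hh !eqxx //.
Qed.

(** Followers are closed under products: if s moves i, then i and h i choose
    each other, so every follower permutes these two points. *)
Lemma followers_sum_ge0 m (p : 'I_m.+1 -> 'I_m.+1) d h
    (chi : 'CF([set: 'S_m.+1])) :
    depth_for p d -> tree_arrow p h -> chi \is a character ->
  0 <= \sum_(s in followers h) chi s.
Proof.
move=> dP hP chiC.
have gF : group_set (followers h).
  apply/group_setP; split=> [|s t sF tF].
    by apply/followersP=> i; left; rewrite perm1.
  apply/followersP=> i; rewrite permM.
  have [->|si] := eqVneq (s i) i; first by have /followersP := tF.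
  have [-> _ hh] := follower_swap dP hP sF si.
  by have /followersP/(_ (h i)) := tF; rewrite hh => -[]; auto.
exact: (@char_sum_subgroup_ge0 _ _ (Group gF) _ chiC (subsetT _)).
Qed.

Lemma followers_no_turn m (p : 'I_m.+1 -> 'I_m.+1) d h :
    depth_for p d -> tree_arrow p h -> (forall v, ~~ turns p h v) ->
  followers h = [set 1%g].
Proof.
move=> dP hP hT; apply/setP=> s; rewrite in_set1; apply/idP/eqP => [sF|->].
  apply/permP=> i; rewrite perm1; apply/eqP/negPn/negP=> si.
  by case: (follower_turn dP hP sF si) => [|[]]; rewrite ?(negPf (hT _)).
by apply/followersP=> i; left; rewrite perm1.
Qed.

Lemma followers_one_turn m (p : 'I_m.+1 -> 'I_m.+1) d h u :
    depth_for p d -> tree_arrow p h -> turns p h u ->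
    (forall v, turns p h v -> v = u) ->
  followers h = [set 1%g; tperm u (p u)].
Proof.
move=> dP hP uT uniq_u; have /and3P[u0 /eqP hu /eqP hpu] := uT.
apply/setP=> s; rewrite !inE; apply/idP/orP => [sF|[]/eqP ->]; last first.
- apply/forallP=> i; case: tpermP => [->|->|_ _]; rewrite ?hu ?hpu ?eqxx ?orbT //.
- by apply/forallP=> i; rewrite perm1 eqxx.
have {}sF : s \in followers h by rewrite inE.
have ends i : s i != i -> i = u \/ i = p u.
  by move=> /(follower_turn dP hP sF)[/uniq_u|[/uniq_u ->]]; auto.
have [su|su] := eqVneq (s u) u.
  left; apply/eqP/permP=> i; rewrite perm1; apply/eqP/negPn/negP=> si.
  case: (ends _ si) => ie; rewrite ie ?su ?eqxx // in si.
  have [_ + _] := follower_swap dP hP sF si; rewrite hpu su => up.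
  by rewrite -up su eqxx in si.
right; apply/eqP/permP=> i; have [su1 su2 _] := follower_swap dP hP sF su.
rewrite hu in su1 su2; case: tpermP => [->|->|iu ip] //.
by apply/eqP/negPn/negP=> /ends[].
Qed.

(** With at most one edge chosen from both ends, the followers are the identity
    and possibly one transposition, and all transpositions are conjugate. *)
Lemma followers_sum_eq m (p p' : 'I_m.+1 -> 'I_m.+1) d d' h h'
    (chi : 'CF([set: 'S_m.+1])) :
    depth_for p d -> tree_arrow p h -> depth_for p' d' -> tree_arrow p' h' ->
    turns p h =1 turns p' h' ->
    (forall u v, turns p h u -> turns p h v -> u = v) ->
  \sum_(s in followers h) chi s = \sum_(s in followers h') chi s.
Proof.
move=> dP hP dP' hP' eqT uniqT.
have [/existsP[u uT]|noT] := boolP [exists u, turns p h u]; last first.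
  have noTv v : ~~ turns p h v by move: noT; rewrite negb_exists => /forallP.
  rewrite (followers_no_turn dP hP noTv) (followers_no_turn dP' hP') // => v.
  by rewrite -eqT.
rewrite (followers_one_turn dP hP uT) => [|v vT]; last exact: uniqT.
rewrite (@followers_one_turn _ p' d' h' u) // => [||v]; rewrite -?eqT //; last first.
  by move=> vT; apply: uniqT.
have /and3P[u0 _ _] := uT.
have pu := parent_neq dP u0; have pu' := parent_neq dP' u0.
have ntp (v : 'I_m.+1) : v != u -> tperm u v \notin [set 1%g].
  move=> vu; rewrite inE; apply: contra vu => /eqP/permP/(_ u).
  by rewrite tpermL perm1 => ->.
rewrite !big_setU1 ?big_set1 //=; first last.
- by rewrite inE eq_sym -in_set1 ntp.
- by rewrite inE eq_sym -in_set1 ntp.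
congr (_ + _).
have -> : tperm u (p' u) = (tperm u (p u) ^ tperm (p u) (p' u))%g.
  rewrite tpermJ tpermL; case: tpermP => // /esym/eqP.
    by rewrite (negPf pu).
  by rewrite (negPf pu').
by rewrite cfunJ ?inE.
Qed.

(** * Transporting choices from the star to a tree *)

(** The longest initial segment of u, p u, p (p u), ... that stays inside D, and
    the empty set if u is not in D.  In a rooted tree the depth of v determines its
    position in this sequence, which keeps membership decidable. *)
Definition trail (m : nat) (p : 'I_m.+1 -> 'I_m.+1) (d : 'I_m.+1 -> nat)
    (D : {set 'I_m.+1}) (u : 'I_m.+1) : {set 'I_m.+1} :=
  [set v | [&& (d v <= d u)%N, v == iter (d u - d v) p u &
            [forall k : 'I_(d u - d v).+1, iter k p u \in D]]].

Lemma trailP m (p : 'I_m.+1 -> 'I_m.+1) d (D : {set 'I_m.+1}) u v :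
  reflect [/\ (d v <= d u)%N, v = iter (d u - d v) p u &
              forall k, (k <= d u - d v)%N -> iter k p u \in D]
          (v \in trail p d D u).
Proof.
rewrite inE; apply: (iffP and3P) => [[le /eqP vE /forallP DP]|[le vE DP]].
  by split=> // k; rewrite -ltnS => kP; apply: (DP (Ordinal kP)).
split=> //; first exact/eqP.
by apply/forallP=> -[k kP]; apply: DP.
Qed.

Lemma trail_sub m (p : 'I_m.+1 -> 'I_m.+1) d (D : {set 'I_m.+1}) u v :
  v \in trail p d D u -> v \in D.
Proof. by case/trailP=> _ {2}-> DP; apply: DP. Qed.

Lemma trail_start m (p : 'I_m.+1 -> 'I_m.+1) d (D : {set 'I_m.+1}) u :
  u \in D -> u \in trail p d D u.
Proof.
move=> uD; apply/trailP; rewrite subnn; split=> // k.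
by rewrite leqn0 => /eqP ->.
Qed.

Lemma trail_nonempty m (p : 'I_m.+1 -> 'I_m.+1) d (D : {set 'I_m.+1}) u v :
  v \in trail p d D u -> u \in D.
Proof. by case/trailP=> _ _ /(_ 0%N); apply. Qed.

Lemma trail_pred m (p : 'I_m.+1 -> 'I_m.+1) d (D : {set 'I_m.+1}) u v :
    depth_for p d -> ord0 \notin D -> v \in trail p d D u -> v != u ->
  exists2 c, c \in trail p d D u & p c = v.
Proof.
move=> dP D0 /trailP[le vE DP] vu.
have lt : (0 < d u - d v)%N.
  by rewrite lt0n; apply: contra vu => /eqP k0; rewrite vE k0.
pose c := iter (d u - d v).-1 p u.
have pc : p c = v by rewrite vE -[in RHS](prednK lt).
have cD : c \in D by apply: DP; lia.
have dc : d c = (d v).+1 by rewrite dP ?pc //; apply: contraNneq D0 => <-.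
exists c => //; apply/trailP; rewrite dc; split; first lia.
  by rewrite /c; congr iter; lia.
by move=> k kP; apply: DP; lia.
Qed.

Lemma trail_succ m (p : 'I_m.+1 -> 'I_m.+1) d (D : {set 'I_m.+1}) u v :
    depth_for p d -> ord0 \notin D -> v \in trail p d D u -> p v \in D ->
  p v \in trail p d D u.
Proof.
move=> dP D0 vA pvD; have /trailP[le vE DP] := vA.
have dv : d v = (d (p v)).+1.
  by apply: dP; apply: contraNneq D0 => <-; apply: trail_sub vA.
have kE : (d u - d (p v) = (d u - d v).+1)%N by lia.
apply/trailP; rewrite kE; split; first lia; first by rewrite iterS -vE.
move=> k; rewrite leq_eqVlt => /orP[/eqP ->|]; first by rewrite iterS -vE.
exact: DP.
Qed.

Lemma trail_parent_inj m (p : 'I_m.+1 -> 'I_m.+1) d (D : {set 'I_m.+1}) u :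
  depth_for p d -> ord0 \notin D -> {in trail p d D u &, injective p}.
Proof.
move=> dP D0 v w vA wA pvw.
have nz x : x \in trail p d D u -> x != ord0.
  by move/trail_sub=> xD; apply: contraNneq D0 => <-.
have dvw : d v = d w by rewrite (dP _ (nz _ vA)) (dP _ (nz _ wA)) pvw.
have /trailP[_ -> _] := vA; have /trailP[_ -> _] := wA.
by rewrite dvw.
Qed.

Lemma trail_parent_neq m (p : 'I_m.+1 -> 'I_m.+1) d (D : {set 'I_m.+1}) u v :
  depth_for p d -> ord0 \notin D -> v \in trail p d D u -> p v != u.
Proof.
move=> dP D0 vA; have /trailP[le _ _] := vA.
have v0 : v != ord0 by apply: contraNneq D0 => <-; apply: trail_sub vA.
by apply/eqP=> pvu; move: le; rewrite (dP _ v0) pvu ltnn.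
Qed.

Definition star_parent (m : nat) (v : 'I_m.+1) : 'I_m.+1 := ord0.

(** The edges that a choice h on the star uses, each represented by its leaf; in
    the tree they stand for the edges from these vertices to their parents. *)
Definition used_edges (m : nat) (h : 'I_m.+1 -> 'I_m.+1) : {set 'I_m.+1} :=
  [set v | (v != ord0) && ((h v != v) || (v == h ord0))].

(** The choice on the tree that corresponds to h.  Its used edges are those of
    h; arrows climb towards the root, except that the component of the vertex
    chosen by the centre is directed towards that vertex, by turning the arrows
    along the trail downwards. *)
Definition reroute (m : nat) (p : 'I_m.+1 -> 'I_m.+1) (d : 'I_m.+1 -> nat)
    (h : {ffun 'I_m.+1 -> 'I_m.+1}) : {ffun 'I_m.+1 -> 'I_m.+1} :=
  [ffun w => if [pick v in trail p d (used_edges h) (h ord0) | p v == w]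
             is Some v then v
             else if (w != ord0) && (h w != w) then p w else w].

Lemma used_edges0 m (h : 'I_m.+1 -> 'I_m.+1) : ord0 \notin used_edges h.
Proof. by rewrite inE eqxx. Qed.

Lemma reroute_trail m (p : 'I_m.+1 -> 'I_m.+1) d (h : {ffun 'I_m.+1 -> 'I_m.+1}) v :
    depth_for p d -> v \in trail p d (used_edges h) (h ord0) ->
  reroute p d h (p v) = v.
Proof.
move=> dP vA; rewrite ffunE; case: pickP => [w /andP[wA /eqP pw]|/(_ v)].
  exact: (trail_parent_inj dP (used_edges0 h) wA vA pw).
by rewrite vA eqxx.
Qed.

Lemma reroute_default m (p : 'I_m.+1 -> 'I_m.+1) d
    (h : {ffun 'I_m.+1 -> 'I_m.+1}) w :
    w \notin p @: trail p d (used_edges h) (h ord0) ->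
  reroute p d h w = if (w != ord0) && (h w != w) then p w else w.
Proof.
move=> wA; rewrite ffunE; case: pickP => // v /andP[vA /eqP pv].
by case/negP: wA; rewrite -pv imset_f.
Qed.

(** The trail can be read off from the image, being the set of vertices whose
    parent points down to them.  This is what makes [reroute] injective. *)
Lemma reroute_trailE m (p : 'I_m.+1 -> 'I_m.+1) d
    (h : {ffun 'I_m.+1 -> 'I_m.+1}) v : depth_for p d -> v != ord0 ->
  (v \in trail p d (used_edges h) (h ord0)) = (reroute p d h (p v) == v).
Proof.
move=> dP v0; apply/idP/eqP => [|]; first exact: reroute_trail.
have [/imsetP[w wA pvw]|pvA] := boolP (p v \in p @: trail p d (used_edges h) (h ord0)).
  by rewrite pvw (reroute_trail dP wA) => <-.
rewrite reroute_default //; have pv := parent_neq dP v0.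
case: ifP => [/andP[pv0 _] ppv|_ /eqP]; last by rewrite (negPf pv).
by move: (dP _ v0); rewrite (dP _ pv0) ppv; lia.
Qed.

Lemma reroute_tree_arrow m (p : 'I_m.+1 -> 'I_m.+1) d
    (h : {ffun 'I_m.+1 -> 'I_m.+1}) :
  depth_for p d -> tree_arrow p (reroute p d h).
Proof.
move=> dP w; set A := trail p d (used_edges h) (h ord0).
have [/imsetP[v vA ->]|wA] := boolP (w \in p @: A).
  right; rewrite (reroute_trail dP vA) /parent_rel /= eqxx andbT.
  apply/orP; right; apply: contraNneq (used_edges0 h) => <-.
  exact: trail_sub vA.
rewrite reroute_default //; case: ifP => [/andP[w0 _]|_]; last by left.
by right; rewrite /parent_rel /= w0 eqxx.
Qed.

Lemma star_arrow m (h : 'I_m.+1 -> 'I_m.+1) v :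
  tree_arrow (@star_parent m) h -> v != ord0 -> h v != v -> h v = ord0.
Proof.
move=> hP v0 /eqP hv; case: (hP v) => // /orP[]/andP[] //.
  by move=> _ /eqP <-.
by move=> _ /eqP v0'; rewrite -v0' eqxx in v0.
Qed.

(** In the image every trail vertex except u, the vertex chosen by the centre,
    points down, so only the edge above u can be chosen from both ends.  That
    happens exactly if u itself chose the centre. *)
Lemma reroute_turns m (p : 'I_m.+1 -> 'I_m.+1) d
    (h : {ffun 'I_m.+1 -> 'I_m.+1}) :
    depth_for p d -> tree_arrow (@star_parent m) h ->
  turns p (reroute p d h) =1 turns (@star_parent m) h.
Proof.
move=> dP hP v; rewrite /turns /=; case: (boolP (v == ord0)) => //= v0.
rewrite -reroute_trailE // /star_parent.
set A := trail p d (used_edges h) (h ord0).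
apply/andP/andP => [[/eqP rv vA]|[/eqP hv /eqP h0]].
  have vu : v = h ord0.
    apply/eqP/negPn/negP=> vu.
    have [c cA pc] := trail_pred dP (used_edges0 h) vA vu.
    move: rv; rewrite -{1}pc (reroute_trail dP cA) => cpv.
    have c0 : c != ord0.
      by apply: contraNneq (used_edges0 h) => <-; apply: trail_sub cA.
    by move: (dP _ c0) (dP _ v0); rewrite pc -cpv; lia.
  split; last by rewrite -vu.
  have vpA : v \notin p @: A.
    apply/imsetP=> -[c cA pc].
    by have := trail_parent_neq dP (used_edges0 h) cA; rewrite -pc vu eqxx.
  move: rv; rewrite reroute_default // v0 /=.
  have [hv pv|hv _] := eqVneq (h v) v.
    by have := parent_neq dP v0; rewrite -pv eqxx.
  by apply/eqP; apply: star_arrow.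
have hvv : h v != v by rewrite hv eq_sym.
have vD : v \in used_edges h by rewrite inE v0 hvv.
split; last by rewrite /A h0 trail_start.
rewrite reroute_default ?v0 ?hvv //; apply/imsetP=> -[c cA pc].
by have := trail_parent_neq dP (used_edges0 h) cA; rewrite h0 -pc eqxx.
Qed.

(** If the centre chooses u, the image moves the leaves moved by
    h and the parents of the trail vertices.  Among these parents exactly one,
    the parent of the last trail vertex, is a new moved vertex: the others are
    the trail vertices different from u, which h moves.  That new vertex takes
    the place of the centre. *)
Lemma card_moved_reroute m (p : 'I_m.+1 -> 'I_m.+1) d
    (h : {ffun 'I_m.+1 -> 'I_m.+1}) :
    depth_for p d -> tree_arrow (@star_parent m) h ->
  #|[pred i | reroute p d h i != i]| = #|[pred i | h i != i]|.
Proof.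
move=> dP hP.
set u := h ord0; set D := used_edges h; set A := trail p d D u.
have D0 : ord0 \notin D := used_edges0 h.
pose F := [set v | (v != ord0) && (h v != v)].
have FD v : v \in F -> v \in D by rewrite !inE => /andP[-> ->].
have movedE : [pred i | reroute p d h i != i] =i F :|: p @: A.
  move=> w; rewrite !inE orbC.
  have [/imsetP[v vA ->]|wA] := boolP (w \in p @: A).
    rewrite (reroute_trail dP vA) eq_sym (parent_neq dP) //.
    by apply: contraNneq D0 => <-; apply: trail_sub vA.
  rewrite reroute_default //=; case: ifP => [/andP[w0 _]|_].
    by rewrite (parent_neq dP w0).
  by rewrite eqxx.
have FpA : F :&: (p @: A) = A :\ u.
  apply/setP=> w; rewrite inE in_setD1.
  apply/andP/andP => [[wF /imsetP[v vA wv]]|[wu wA]].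
    rewrite wv; split; first exact: trail_parent_neq vA.
    by apply: trail_succ => //; rewrite -wv FD.
  split; last by have [c cA <-] := trail_pred dP D0 wA wu; rewrite imset_f.
  by move/trail_sub: wA; rewrite !inE => /andP[-> /orP[->|/eqP wu']] //;
    rewrite -/u wu' eqxx in wu.
have cA : #|p @: A| = #|A| := card_in_imset (trail_parent_inj dP D0).
have -> : #|[pred i | h i != i]| = ((u != ord0) + #|F|)%N.
  rewrite [LHS](cardD1 ord0) inE -/u; congr (_ + _)%N.
  by apply: eq_card => w; rewrite !inE.
rewrite (eq_card movedE).
have [u0|u0] := eqVneq u ord0.
  have A0 : A = set0.
    apply/setP=> v; rewrite in_set0; apply/negP=> /trail_nonempty.
    by rewrite u0 (negPf D0).
  by rewrite A0 imset0 setU0.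
have uA : u \in A by apply: trail_start; rewrite inE u0 eqxx orbT.
(* Here #|p @: A| = #|A| and F meets p @: A in A minus u, so the union with
   p @: A adds exactly one point to F. *)
by have := cardsUI F (p @: A); rewrite FpA cA (cardsD1 u A) uA addnCA addnA => /addIn ->.
Qed.

(** The trail is determined by the image.  It is empty if the centre chooses
    nothing; otherwise the chosen vertex is the only trail vertex that is not the
    parent of another one.  A leaf v is moved by h if and only if the image
    moves it, except when v is the parent of a trail vertex: then v is always
    moved by the image, and it is moved by h exactly if it lies on the trail. *)
Lemma reroute_inj m (p : 'I_m.+1 -> 'I_m.+1) d
    (h g : {ffun 'I_m.+1 -> 'I_m.+1}) :
    depth_for p d -> tree_arrow (@star_parent m) h ->
    tree_arrow (@star_parent m) g ->
  reroute p d h = reroute p d g -> h = g.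
Proof.
move=> dP hP gP eq_hg.
pose A (h : {ffun 'I_m.+1 -> 'I_m.+1}) := trail p d (used_edges h) (h ord0).
have A0 (f : {ffun 'I_m.+1 -> 'I_m.+1}) v : v \in A f -> v != ord0.
  by move/trail_sub=> vD; apply: contraNneq (used_edges0 f) => <-.
have eqA : A h = A g.
  apply/setP=> v; have [->|v0] := eqVneq v ord0.
    by apply/idP/idP => /A0; rewrite eqxx.
  by rewrite /A !reroute_trailE // eq_hg.
have startA (f : {ffun 'I_m.+1 -> 'I_m.+1}) : f ord0 != ord0 -> f ord0 \in A f.
  by move=> f0; apply: trail_start; rewrite inE f0 eqxx orbT.
have startU (f f' : {ffun 'I_m.+1 -> 'I_m.+1}) : A f = A f' ->
    f ord0 != ord0 -> f ord0 = f' ord0.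
  move=> eqAf f0; apply/eqP/negPn/negP=> ne.
  have fA : f ord0 \in A f' by rewrite -eqAf startA.
  have [c] := trail_pred dP (used_edges0 f') fA ne; rewrite -/(A f') -eqAf => cA pc.
  by have := trail_parent_neq dP (used_edges0 f) cA; rewrite pc eqxx.
have eq0 : h ord0 = g ord0.
  have [h0|h0] := eqVneq (h ord0) ord0; last exact: startU.
  have [g0|g0] := eqVneq (g ord0) ord0; first by rewrite h0 g0.
  by rewrite -(startU g h).
have movedE (f : {ffun 'I_m.+1 -> 'I_m.+1}) v : v != ord0 ->
    (f v != v) = if v \in p @: A f then v \in A f else reroute p d f v != v.
  move=> v0; case: (boolP (v \in p @: A f)) => vpA; last first.
    rewrite reroute_default // v0 /=; case: ifP => //.
      by rewrite (parent_neq dP v0).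
    by rewrite eqxx.
  have /imsetP[c cA vc] := vpA.
  have vu : v != f ord0 by rewrite vc (trail_parent_neq dP (used_edges0 f) cA).
  apply/idP/idP => [fv|/trail_sub]; last by rewrite inE (negPf vu) orbF v0.
  by rewrite vc; apply: trail_succ => //; rewrite ?used_edges0 // -vc inE v0 fv.
apply/ffunP=> v; have [->//|v0] := eqVneq v ord0.
have : (h v != v) = (g v != v) by rewrite (movedE h) // (movedE g) // eqA eq_hg.
have [hv /esym/negbFE/eqP gv|hv /esym gv] := eqVneq (h v) v.
  by rewrite hv gv.
by rewrite (star_arrow hP v0 hv) (star_arrow gP v0 gv).
Qed.

(** * The star and trees *)

Lemma star_depth m : depth_for (@star_parent m) (fun v => (v != ord0) : nat).
Proof. by move=> v v0; rewrite v0 /star_parent eqxx. Qed.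

Lemma laplacian_eq n (e e' : rel 'I_n) : e =2 e' -> laplacian e = laplacian e'.
Proof.
move=> ee; apply/matrixP=> i j; rewrite !mxE ee; congr (_%:R *+ _ - _).
by apply: eq_card => k; rewrite !inE ee.
Qed.

Lemma star_parent_rel m : star (n := m.+1) =2 parent_rel (@star_parent m).
Proof.
move=> i j; rewrite /parent_rel /star_parent /star /=.
have E (k : 'I_m.+1) : (k == 0%N :> nat) = (k == ord0) by [].
rewrite !E !(eq_sym ord0).
have [i0|i0] := eqVneq i ord0; have [j0|j0] := eqVneq j ord0 => /=.
- by rewrite i0 j0 eqxx.
- by rewrite i0 eq_sym j0.
- by rewrite j0 i0.
- by rewrite andbF.
Qed.

(** [reroute] maps the choices on the star injectively to choices on the tree
    with the same contribution; the remaining choices on the tree contribute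
    nonnegatively. *)
Lemma imm_coef_star_le_tree m (p : 'I_m.+1 -> 'I_m.+1) d lam r :
    depth_for p d -> (r <= m.+1)%N ->
  imm_coef lam r (laplacian (star (n := m.+1))) <=
  imm_coef lam r (laplacian (parent_rel p)).
Proof.
move=> dP le_rn; rewrite (laplacian_eq (@star_parent_rel m)).
have arrowsP (q : 'I_m.+1 -> 'I_m.+1) (h : {ffun 'I_m.+1 -> 'I_m.+1}) :
    arrows (parent_rel q) r h ->
    tree_arrow q h /\ #|[pred i | h i != i]| = r.
  case/andP=> /forallP hP /eqP cr; split=> // i.
  by case/orP: (hP i) => [/eqP|]; [left | right].
rewrite (imm_coef_tree _ (@star_depth m)) // (imm_coef_tree _ dP) //.
pose t (h : {ffun 'I_m.+1 -> 'I_m.+1}) :=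
  \sum_(s in followers h) sym_char m.+1 lam s.
pose S := [set h | arrows (parent_rel (@star_parent m)) r h].
rewrite -/t.
have -> : \sum_(h | arrows (parent_rel (@star_parent m)) r h) t h =
    \sum_(h in reroute p d @: S) t h.
  rewrite big_imset /= => [|h g]; last first.
    rewrite !inE => /arrowsP[hP _] /arrowsP[gP _]; exact: reroute_inj.
  apply: eq_big => [h|h /arrowsP[hP _]]; first by rewrite inE.
  apply: (followers_sum_eq _ (@star_depth m) hP dP (reroute_tree_arrow h dP)).
    by move=> v; rewrite reroute_turns.
  by move=> u v /and3P[_ _ /eqP <-] /and3P[_ _ /eqP <-].
rewrite [leRHS](bigID (fun h => h \in reroute p d @: S)) /=.
rewrite (eq_bigl (fun h => arrows (parent_rel p) r h && (h \in reroute p d @: S))).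
  rewrite lerDl; apply: sumr_ge0 => h /andP[/arrowsP[hP _] _].
  exact: (followers_sum_ge0 dP hP (sym_char_char _ _)).
move=> h; rewrite andbC; case: (boolP (h \in _)) => //= /imsetP[g].
rewrite inE => /arrowsP[gP cr] ->; apply/esym/andP; split.
  by apply/forallP=> i; case: (reroute_tree_arrow g dP i) => ->; rewrite ?eqxx ?orbT.
by rewrite card_moved_reroute // cr.
Qed.

(** * Spanning trees and conclusion *)

(** A breadth-first tree: d is the distance from the root, and p v is the
    vertex before v on a shortest path. *)
Lemma connected_spanning_tree m (e : rel 'I_m.+1) :
    symmetric e -> connected e ->
  exists p d, depth_for p d /\ subrel (parent_rel p) e.
Proof.
move=> e_sym e_conn.
pose reach v k := [exists s : k.-tuple 'I_m.+1, path e ord0 s && (last ord0 s == v)].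
have reachP v s : path e ord0 s -> last ord0 s = v -> reach v (size s).
  move=> es ls; apply/existsP; exists (in_tuple s).
  by rewrite /= es ls eqxx.
have ex v : exists k, reach v k.
  by have /connectP[s es ->] := e_conn ord0 v; exists (size s); apply: reachP.
pose d v := ex_minn (ex v).
have dmin v s : path e ord0 s -> last ord0 s = v -> (d v <= size s)%N.
  by move=> es ls; rewrite /d; case: ex_minnP => k _; apply; apply: reachP.
have dpath v : exists s, [/\ path e ord0 s, last ord0 s = v & size s = d v].
  rewrite /d; case: ex_minnP => k /existsP[s /andP[es /eqP ls]] _.
  by exists s; rewrite size_tuple.
have par v : exists w, v != ord0 -> e v w /\ d v = (d w).+1.
  have [s [es ls ss]] := dpath v; case/lastP: s es ls ss => [|s x].
    by move=> _ <- _; exists ord0; rewrite eqxx.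
  rewrite rcons_path last_rcons size_rcons => /andP[es ex'] xv ss.
  exists (last ord0 s) => _; rewrite -xv e_sym; split=> //.
  have le1 := dmin _ _ es erefl.
  have [s' [es' ls' ss']] := dpath (last ord0 s).
  have := @dmin v (rcons s' x); rewrite rcons_path es' ls' ex' last_rcons size_rcons.
  by move=> /(_ isT xv); rewrite xv; lia.
have [p pP] := fin_all_exists par.
exists p, d; split=> [v v0|i j]; first by case: (pP v v0).
case/orP=> /andP[v0 /eqP <-]; first by case: (pP _ v0).
by rewrite e_sym; case: (pP _ v0).
Qed.

Theorem corollary3p9 (n : nat) (e : rel 'I_n)
    (e_sym : symmetric e) (e_irr : irreflexive e)
    (lam : seq nat) (lam_n : is_partition n lam)
    (r : nat) (r_le_n : (r <= n)%N) :
  (connected e ->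
     imm_coef lam r (laplacian (star (n := n)))
       <= imm_coef lam r (laplacian e)) /\
  imm_coef lam r (laplacian e) <= imm_coef lam r (laplacian (complete (n := n))).
Proof.
split=> [e_conn|]; last first.
  apply: imm_coef_laplacian_mono => // [i j|i|i j eij].
  - by rewrite /complete /= eq_sym.
  - by rewrite /complete /= eqxx.
  - by rewrite /complete /=; apply/eqP=> ij; rewrite ij e_irr in eij.
(* With no vertices there is no root, but also only one Laplacian. *)
clear lam_n; case: n => [|m] in e e_sym e_irr r_le_n e_conn *.
  suff -> : laplacian (star (n := 0)) = laplacian e by [].
  by apply/matrixP=> -[].
have [p [d [dP sub_e]]] := connected_spanning_tree e_sym e_conn.
apply: le_trans (imm_coef_star_le_tree lam dP r_le_n) _.
apply: imm_coef_laplacian_mono => //; first exact: parent_rel_sym.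
exact: parent_rel_irr dP.
Qed.
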